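(* Let $M$ be a locally finite module over $\mathfrak{G} = \mathrm{Gal}(\overline{\mathbb{F}_q}/\mathbb{F}_q)$ with a polynomial $\zeta$-quotient $P_M(t) = \frac{\zeta_M(t)}{\zeta_{\mathbb{P}^1(\overline{\mathbb{F}_q})}(t)} \in \mathbb{Z}[t]$ of degree $\deg P_M(t) = d \in \mathbb{N}$ with leading coefficient $a_d \in \mathbb{Z}$, and let $\lambda := \log_q \sqrt[d]{|a_d|} \in \mathbb{R}^{\geq 0}$. The following conditions are equivalent: (i) $M$ satisfies the Riemann Hypothesis Analogue with respect to $\mathbb{P}^1(\overline{\mathbb{F}_q})$ as a $\mathfrak{G}$-module; (ii) $q^r + 1 - dq^{\lambda r} \leq |M^{\Phi_{q^r}}| \leq q^r + 1 + dq^{\lambda r}$ for all $r \in \mathbb{N}$; (iii) there exist constants $C_1, C_2 \in \mathbb{R}^{>0}$ and $\nu, r_1, r_2 \in \mathbb{N}$, such that $$|M^{\Phi_{q^{\nu r}}}| \leq q^{\nu r} + 1 + C_1 q^{\lambda\nu r} \quad \text{for all } r \in \mathbb{N},\ r \geq r_1, \quad\text{and}$$ $$|M^{\Phi_{q^{\nu r}}}| \geq q^{\nu r} + 1 - C_2 q^{\lambda\nu r} \quad \text{for all } r \in \mathbb{N},\ r \geq r_2.$$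
   Context: $\mathbb{F}_q$ is a finite field, $\Phi_q(a)=a^q$ is the Frobenius automorphism, $\Phi_{q^r}=\Phi_q^r$, and $\mathfrak{G}$ is the profinite completion of $\langle\Phi_q\rangle$. $\mathbb{N}=\{1,2,\dots\}$. A $\mathfrak{G}$-module is a set with an action of $\mathfrak{G}$; it is locally finite if all orbits are finite and for every $n\in\mathbb{N}$ there are at most finitely many orbits of cardinality $n$. The degree $\deg\nu$ of an orbit $\nu$ is its cardinality. $\zeta_M(t)=\prod_\nu\frac{1}{1-t^{\deg\nu}}$, the product over all $\mathfrak{G}$-orbits $\nu$ on $M$; $\zeta_{\mathbb{P}^1(\overline{\mathbb{F}_q})}(t)=\frac{1}{(1-t)(1-qt)}$. $M^{\Phi_{q^r}}=\{x\in M:\Phi_q^r(x)=x\}$ (a finite set). $M$ satisfies the Riemann Hypothesis Analogue with respect to $\mathbb{P}^1(\overline{\mathbb{F}_q})$ if $P_M(t)=\sum_{i=0}^da_it^i=\prod_{i=1}^d(1-\omega_it)\in\mathbb{C}[t]$ is a polynomial with $|\omega_i|=\sqrt[d]{|a_d|}$ for all $1\le i\le d$. *)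

(* Defs.v *)
From HB Require Import structures.
From mathcomp Require Import all_boot all_order all_algebra all_fingroup all_field.
From mathcomp Require Import finmap complex.
From mathcomp Require Import all_classical all_reals all_analysis.
Set Implicit Arguments.
Unset Strict Implicit.
Unset Printing Implicit Defensive.
Import Order.TTheory GRing.Theory Num.Theory.
Local Open Scope classical_set_scope.
Local Open Scope ring_scope.

(* Formal power series: [fps_coef u n] is the coefficient of t^n in u. A record
   is used because [nat -> R] already carries the pointwise product. *)
Record fps (R : comNzRingType) := Fps { fps_coef : nat -> R }.

Section FpsRing.
Variable R : comNzRingType.
Implicit Types u v w : fps R.

HB.instance Definition _ := gen_eqMixin (fps R).
HB.instance Definition _ := gen_choiceMixin (fps R).

Lemma fpsP u v : fps_coef u =1 fps_coef v -> u = v.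
Proof. by case: u v => [u] [v] /= /funext ->. Qed.

Definition fps_zero : fps R := Fps (fun=> 0).
Definition fps_one : fps R := Fps (fun n => (n == 0%N)%:R).
Definition fps_opp u : fps R := Fps (fun n => - fps_coef u n).
Definition fps_add u v : fps R := Fps (fun n => fps_coef u n + fps_coef v n).
Definition fps_mul u v : fps R :=
  Fps (fun n => \sum_(i < n.+1) fps_coef u i * fps_coef v (n - i)).

Definition fps_trunc m u : {poly R} := \poly_(i < m) fps_coef u i.

Lemma coef_fps_trunc m u i : (i < m)%N -> (fps_trunc m u)`_i = fps_coef u i.
Proof. by move=> im; rewrite coef_poly im. Qed.

Lemma fps_mul_trunc m u v n : (n < m)%N ->
  fps_coef (fps_mul u v) n = (fps_trunc m u * fps_trunc m v)`_n.
Proof.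
move=> nm; rewrite coefM /=; apply: eq_bigr => i _.
rewrite !coef_fps_trunc //; first exact: leq_ltn_trans (leq_subr _ _) nm.
by apply: leq_ltn_trans nm; rewrite -ltnS.
Qed.

Lemma coef_poly_mul_eq (p p' r r' : {poly R}) n :
  (forall i, (i <= n)%N -> p`_i = p'`_i) ->
  (forall i, (i <= n)%N -> r`_i = r'`_i) -> (p * r)`_n = (p' * r')`_n.
Proof.
move=> pp' rr'; rewrite !coefM; apply: eq_bigr => i _.
by rewrite pp' ?rr' ?leq_subr // -ltnS.
Qed.

Lemma fps_addA : associative fps_add.
Proof. by move=> u v w; apply: fpsP => n /=; rewrite addrA. Qed.
Lemma fps_addC : commutative fps_add.
Proof. by move=> u v; apply: fpsP => n /=; rewrite addrC. Qed.
Lemma fps_add0 : left_id fps_zero fps_add.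
Proof. by move=> u; apply: fpsP => n /=; rewrite add0r. Qed.
Lemma fps_addN : left_inverse fps_zero fps_opp fps_add.
Proof. by move=> u; apply: fpsP => n /=; rewrite addNr. Qed.

Lemma fps_mulC : commutative fps_mul.
Proof.
by move=> u v; apply: fpsP => n; rewrite !(@fps_mul_trunc n.+1) // mulrC.
Qed.

Lemma fps_mulA : associative fps_mul.
Proof.
move=> u v w; apply: fpsP => n; rewrite !(@fps_mul_trunc n.+1) //.
transitivity ((fps_trunc n.+1 u * (fps_trunc n.+1 v * fps_trunc n.+1 w))`_n).
  apply: coef_poly_mul_eq => // i le_in.
  by rewrite coef_fps_trunc ?ltnS // (@fps_mul_trunc n.+1).
rewrite mulrA; apply: coef_poly_mul_eq => // i le_in.
by rewrite coef_fps_trunc ?ltnS // (@fps_mul_trunc n.+1).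
Qed.

Lemma fps_mul1 : left_id fps_one fps_mul.
Proof.
move=> u; apply: fpsP => n /=; rewrite big_ord_recl /= mul1r subn0.
by rewrite big1 ?addr0 // => i _; rewrite mul0r.
Qed.

Lemma fps_mulDl : left_distributive fps_mul fps_add.
Proof.
move=> u v w; apply: fpsP => n /=; rewrite -big_split /=.
by apply: eq_bigr => i _; rewrite mulrDl.
Qed.

Lemma fps_one_neq0 : fps_one != fps_zero.
Proof.
apply/eqP => /(congr1 (fun u => fps_coef u 0)) /=.
by move/eqP; rewrite oner_eq0.
Qed.

HB.instance Definition _ :=
  GRing.isZmodule.Build (fps R) fps_addA fps_addC fps_add0 fps_addN.
HB.instance Definition _ := GRing.Zmodule_isComNzRing.Build (fps R)
  fps_mulA fps_mulC fps_mul1 fps_mulDl fps_one_neq0.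

Lemma fps_coefM u v n :
  fps_coef (u * v) n = \sum_(i < n.+1) fps_coef u i * fps_coef v (n - i).
Proof. by []. Qed.

Lemma fps_coef1 n : fps_coef 1 n = (n == 0%N)%:R :> R.
Proof. by []. Qed.

Definition fps_of_poly (p : {poly R}) : fps R := Fps (fun n => p`_n).

(* 1 / (1 - c t^k) for k > 0; see [fps_geomP]. *)
Definition fps_geom (c : R) (k : nat) : fps R :=
  Fps (fun n => if (k %| n)%N then c ^+ (n %/ k) else 0).

Lemma fps_geomP c k : (0 < k)%N ->
  fps_of_poly (1 - c *: 'X^k) * fps_geom c k = 1.
Proof.
move=> k0; apply: fpsP => n; rewrite fps_coefM fps_coef1 /=.
under eq_bigr do rewrite coefB coef1 coefZ coefXn mulrBl.
rewrite sumrB big_ord_recl /= mul1r subn0 [X in _ + X - _]big1 ?addr0; last first.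
  by move=> i _; rewrite mul0r.
have [lt_nk|le_kn] := ltnP n k.
  rewrite big1 ?subr0 => [|i _]; last first.
    rewrite [_ == k]ltn_eqF ?mulr0 ?mul0r //.
    by apply: leq_ltn_trans lt_nk; rewrite -ltnS.
  case: n lt_nk => [|n] lt_nk; first by rewrite dvdn0 div0n expr0.
  by rewrite gtnNdvd.
have kn : (k < n.+1)%N by [].
rewrite (bigD1 (Ordinal kn)) //= eqxx mulr1 big1 ?addr0; last first.
  by move=> i; rewrite -val_eqE /= => /negPf ->; rewrite mulr0 mul0r.
rewrite (gtn_eqF (leq_trans k0 le_kn)) -{1 2}(subnK le_kn) dvdn_addl //.
case: ifP => [_|_]; last by rewrite mulr0 subr0.
by rewrite divnDr ?dvdnn // divnn k0 addn1 exprS subrr.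
Qed.

End FpsRing.

(* K is an algebraic closure of the finite field F, embedded by iota. *)
Definition is_algebraic_closure (F : finFieldType) (K : closedFieldType)
  (iota : {rmorphism F -> K}) : Prop := forall x : K, algebraicOver iota x.

Section AbsoluteGaloisGroup.
Variables (F : finFieldType) (K : closedFieldType) (iota : {rmorphism F -> K}).

(* Gal(K / F); [gal_group] makes it a group under composition. *)
Record gal : Type := Gal {
  gal_fun :> K -> K;
  gal_zmod : zmod_morphism gal_fun;
  gal_monoid : monoid_morphism gal_fun;
  gal_bij : bijective gal_fun;
  gal_fix : forall a : F, gal_fun (iota a) = iota a }.

HB.instance Definition _ := gen_eqMixin gal.
HB.instance Definition _ := gen_choiceMixin gal.

Lemma galP (s t : gal) : s =1 t -> s = t.
Proof.
case: s t => [f f1 f2 f3 f4] [g g1 g2 g3 g4] /= /funext fg; subst g.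
by congr Gal; apply: Prop_irrelevance.
Qed.

Definition gal_one : gal.
Proof. by apply: (@Gal idfun) => //; exists idfun. Defined.

Definition gal_mul (s t : gal) : gal.
Proof.
apply: (@Gal (s \o t)) => [x y||| a] /=.
- by rewrite (gal_zmod t) (gal_zmod s).
- have [s1 sM] := gal_monoid s; have [t1 tM] := gal_monoid t.
  by split=> [|x y] /=; rewrite ?t1 ?s1 ?tM ?sM.
- exact: bij_comp (gal_bij s) (gal_bij t).
- by rewrite (gal_fix t) (gal_fix s).
Defined.

Lemma gal_inv_ex (s : gal) : {t : gal | cancel s t & cancel t s}.
Proof.
have [g sK gK] : {g | cancel s g & cancel g s}.
  have /cid[g [sK gK]] : exists g, cancel s g /\ cancel g s.
    by case: (gal_bij s) => g; exists g.
  by exists g.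
suff t : {t : gal | gal_fun t = g} by case: t => t tE; exists t; rewrite tE.
have [s1 sM] := gal_monoid s.
have gB : zmod_morphism g.
  by move=> x y; apply: (can_inj sK); rewrite (gal_zmod s) !gK.
have gM : monoid_morphism g.
  by split=> [|x y]; apply: (can_inj sK); rewrite ?sM !gK ?s1.
have gb : bijective g by exists s.
have gF (a : F) : g (iota a) = iota a.
  by apply: (can_inj sK); rewrite gK (gal_fix s).
by exists (Gal gB gM gb gF).
Qed.

Definition gal_inv (s : gal) : gal := s2val (gal_inv_ex s).

Lemma gal_mulA : associative gal_mul. Proof. by move=> s t u; apply: galP. Qed.
Lemma gal_mul1 : left_id gal_one gal_mul. Proof. by move=> s; apply: galP. Qed.
Lemma gal_1mul : right_id gal_one gal_mul. Proof. by move=> s; apply: galP. Qed.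
Lemma gal_mulV : left_inverse gal_one gal_inv gal_mul.
Proof.
by move=> s; apply: galP => x /=; rewrite /gal_inv; case: (gal_inv_ex s) => /= t ->.
Qed.
Lemma gal_Vmul : right_inverse gal_one gal_inv gal_mul.
Proof.
by move=> s; apply: galP => x /=; rewrite /gal_inv; case: (gal_inv_ex s) => /= t _ ->.
Qed.

HB.instance Definition gal_group :=
  isGroup.Build gal gal_mulA gal_mul1 gal_1mul gal_mulV gal_Vmul.

Lemma frobenius_zmod : zmod_morphism (fun x : K => x ^+ #|F|).
Proof.
have [p pr_p pF] := finPcharP F.
have qp : [pchar K].-nat #|F|.
  have pK : p \in [pchar K] by rewrite (fmorph_pchar iota).
  rewrite (eq_pnat _ (pcharf_eq pK)).
  have -> : #|F| = (p ^ logn p #|F|)%N.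
    have E := card_pprimeChar pF.
    by rewrite -[#|F|]/#|pPrimeCharType pF| E pfactorK.
  by rewrite pnatX pnat_id.
by move=> x y /=; rewrite exprDn_pchar // exprNn_pchar.
Qed.

Lemma frobenius_monoid : monoid_morphism (fun x : K => x ^+ #|F|).
Proof. by split=> [|x y]; rewrite ?expr1n ?exprMn. Qed.

Lemma frobenius_bij : bijective (fun x : K => x ^+ #|F|).
Proof.
have F0 : (0 < #|F|)%N by rewrite (cardD1 0).
rewrite -setTT_bijective; split=> [x //|x y _ _ /= xy|y _].
  apply/eqP; rewrite -subr_eq0.
  suff : (x - y) ^+ #|F| == 0 by rewrite expf_eq0 => /andP[].
  by rewrite frobenius_zmod /= xy subrr.
have /closed_rootP[x] : size ('X^#|F| - y%:P) != 1%N.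
  by rewrite size_XnsubC // eqSS -lt0n.
rewrite rootE !hornerE subr_eq0 => /eqP xy.
by exists x.
Qed.

Lemma frobenius_fix (a : F) : iota a ^+ #|F| = iota a.
Proof. by rewrite -rmorphXn expf_card. Qed.

Definition frobenius : gal :=
  Gal frobenius_zmod frobenius_monoid frobenius_bij frobenius_fix.

(* A set with a left action of Gal(K / F); no continuity is required.
   Every type is a choiceType classically. *)
Record galModule : Type := GalModule {
  gm_carrier :> choiceType;
  gm_act : gal -> gm_carrier -> gm_carrier;
  gm_act1 : forall x, gm_act 1%g x = x;
  gm_actM : forall s t x, gm_act (s * t)%g x = gm_act s (gm_act t x) }.

Definition orbits (M : galModule) : set (set M) :=
  [set O | exists x : M, O = range (fun s => gm_act s x)].
Arguments orbits : clear implicits.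

(* Junk value 0 when O is infinite. *)
Definition deg (M : galModule) (O : set M) : nat := #|` fset_set O|%fset.

Definition locally_finite (M : galModule) : Prop :=
  (forall O, orbits M O -> finite_set O) /\
  (forall n : nat, (0 < n)%N ->
     finite_set [set O | orbits M O /\ deg O = n]).

(* The infinite product over all orbits of 1 / (1 - t^(deg O)), for M locally
   finite: the factors with deg O > n are 1 modulo t^(n+1), so that the
   coefficient of t^n is that of the finite product over deg O <= n. *)
Definition zeta (M : galModule) : fps int :=
  Fps (fun n => fps_coef
    (\big[*%R/1]_(O \in [set O | orbits M O /\ (deg O <= n)%N])
        fps_geom (1 : int) (deg O)) n).

(* 1 / ((1 - t) (1 - q t)) *)
Definition zeta_P1 : fps int := fps_geom 1 1 * fps_geom #|F|%:R 1.

Definition is_zeta_quotient (M : galModule) (P : {poly int}) : Prop :=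
  fps_of_poly P * zeta_P1 = zeta M.

Definition fixed_points (M : galModule) (r : nat) : set M :=
  [set x : M | gm_act (frobenius ^+ r)%g x = x].
Arguments fixed_points : clear implicits.

Definition card_fixed (M : galModule) (r : nat) : nat :=
  #|` fset_set (fixed_points M r)|%fset.

End AbsoluteGaloisGroup.

(* |a_d|^(1/d), where d is the degree of P and a_d its leading coefficient. *)
Definition root_abs_lead (R : realType) (P : {poly int}) : R :=
  `|lead_coef P|%:~R `^ ((size P).-1%:R)^-1.

(* P is unique when it exists, as zeta_P1 is invertible; w lists the inverses of
   its complex roots, with multiplicity. *)
Definition riemann_hypothesis_analogue (R : realType) (F : finFieldType)
    (K : closedFieldType) (iota : {rmorphism F -> K}) (M : galModule iota) :=
  exists (P : {poly int}) (w : (size P).-1.-tuple R[i]),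
    [/\ is_zeta_quotient M P,
        map_poly intr P = \prod_(i < (size P).-1) (1 - tnth w i *: 'X)
      & forall i, `|tnth w i| = (root_abs_lead R P)%:C%C].

(* Main.v *)
From HB Require Import structures.
Require Import Defs.
From mathcomp Require Import all_boot all_order all_algebra all_fingroup all_solvable all_field.
From mathcomp Require Import finmap complex ring lra.
From mathcomp Require Import all_classical all_reals all_analysis.
Set Implicit Arguments.
Unset Strict Implicit.
Unset Printing Implicit Defensive.
Import Order.TTheory GRing.Theory Num.Theory.
Local Open Scope ring_scope.

(** Write N_r for the number of fixed points of Phi^r on M. The theorem rests on
    the explicit formula [card_fixed_power_sum]: if
    P_M(t) = prod_i (1 - w_i t), then for all r > 0
      N_r = q^r + 1 - sum_i w_i^r.
    Given it, put rho = |a_d|^(1/d) = q^lambda. The Riemann Hypothesis Analogue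
    says that |w_i| = rho for all i, so it implies |N_r - q^r - 1| <= d rho^r by
    the triangle inequality, and the asymptotic bounds are a special case of
    these. Conversely, asymptotic bounds say that the power sums of the numbers
    w_i^nu are O(rho^(nu r)), which forces |w_i| <= rho for each i
    ([power_sum_bound_terms]: a polynomial in the shift operator isolates one
    term of the sum, so no cancellation can hide a large w_i). But
    prod_i |w_i| = |a_d| = rho^d, so each of these inequalities is an equality
    ([prod_extremal]).

    The explicit formula is obtained by comparing the logarithmic derivatives
    t u'/u of both sides of P_M zeta_(P^1) = zeta_M. A factor 1/(1 - c t^k)
    contributes k sum_(j > 0) c^j t^(k j). Hence zeta_M contributes at t^r the
    sum of the degrees of the orbits whose degree divides r, and one has to know
    that this is N_r: Phi must act on a finite orbit of degree n as an n-cycle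
    ([frobenius_fix_deg]).

    The action of the Galois group is not assumed continuous, so the last point
    uses that subgroups of finite index of the profinite integers are open. The
    concrete form is [gal_frobenius_mul_exp]: for every N > 0, each Galois
    automorphism is Phi^k t^N for some k and some automorphism t. On an orbit of
    degree n every n!-th power acts trivially, so with N = n! the powers of Phi
    alone are transitive on the orbit. *)

(** * The Frobenius topologically generates the Galois group *)

Lemma pigeonhole_nat (T : eqType) (f : nat -> T) (s : seq T) :
  (forall i, f i \in s) -> exists i j, (i < j <= size s)%N /\ f i = f j.
Proof.
move=> fs; have : ~~ uniq (map f (seq.iota 0 (size s).+1)).
  apply/negP=> /(@uniq_leq_size _ _ s); rewrite size_map size_iota ltnn.
  by move=> H; apply: notF; apply: H => _ /mapP[i _ ->].
case/(uniqPn (f 0)) => i [j [ltij]]; rewrite size_map size_iota => ltj.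
rewrite !(nth_map 0) ?size_iota ?nth_iota ?(ltn_trans ltij) // !add0n => eqf.
by exists i, j; rewrite ltij -ltnS.
Qed.

Section FrobeniusTopologicallyGenerates.
Variables (F : finFieldType) (K : closedFieldType) (iota : {rmorphism F -> K}).
Local Notation q := #|F|.
Local Notation Phi := (frobenius iota).
Implicit Types (x y g : K) (s t : Defs.gal iota) (m n k : nat).

HB.instance Definition _ s :=
  GRing.isZmodMorphism.Build K K (gal_fun s) (gal_zmod s).
HB.instance Definition _ s :=
  GRing.isMonoidMorphism.Build K K (gal_fun s) (gal_monoid s).

Lemma card_finField_gt1 : (1 < q)%N. Proof. exact: finNzRing_gt1. Qed.

Lemma frobenius_expE k x : (Phi ^+ k)%g x = x ^+ (q ^ k).
Proof.
elim: k => [|k IHk]; first by rewrite expr1.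
by rewrite expgS -[LHS]/((Phi ^+ k)%g x ^+ q) IHk -exprM expnSr.
Qed.

Lemma frobenius_pow_inj k : injective (fun x => x ^+ (q ^ k)).
Proof.
move=> x y; rewrite -!frobenius_expE; exact: (bij_inj (gal_bij _)).
Qed.

Lemma frobenius_pow_mul m n x : x ^+ (q ^ m) = x -> x ^+ (q ^ (n * m)) = x.
Proof.
by move=> xm; elim: n => [|n IHn]; rewrite ?expr1 // mulSn expnD exprM xm.
Qed.

Lemma frobenius_pow_dvd m n x : (m %| n)%N ->
  x ^+ (q ^ m) = x -> x ^+ (q ^ n) = x.
Proof. by case/dvdnP=> j ->; apply: frobenius_pow_mul. Qed.

Lemma frobenius_pow_mod m a b x : a = b %[mod m] -> x ^+ (q ^ m) = x ->
  x ^+ (q ^ a) = x ^+ (q ^ b).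
Proof.
have modE c : x ^+ (q ^ m) = x -> x ^+ (q ^ c) = x ^+ (q ^ (c %% m)).
  by move=> xm; rewrite {1}(divn_eq c m) expnD exprM frobenius_pow_mul.
by move=> ab xm; rewrite modE // ab -modE.
Qed.

(** X^q - X is the product of the X - a over F, so it has no further roots in K. *)
Lemma frobenius_fixedE x : x ^+ q = x -> exists a, x = iota a.
Proof.
move=> xq; have /(congr1 (fun p => (map_poly iota p).[x])) := finField_genPoly F.
rewrite rmorphB /= map_polyXn map_polyX !hornerE xq subrr rmorph_prod.
move/esym; rewrite horner_prod => /eqP; rewrite prodf_seq_eq0 => /hasP[a _ /=].
by rewrite map_polyXsubC hornerXsubC subr_eq0 => /eqP xa; exists a.
Qed.

(** The Frobenius powers of x are all roots of one polynomial over F, so two of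
    them coincide, and the Frobenius is injective. *)
Lemma algebraic_frobenius_period x : algebraicOver iota x ->
  exists2 m, (0 < m)%N & x ^+ (q ^ m) = x.
Proof.
case=> p p0 rpx; set P := map_poly iota p.
have P0 : P != 0 by rewrite map_poly_eq0.
have rP i : root P (x ^+ (q ^ i)).
  rewrite -frobenius_expE.
  have <- : map_poly (Phi ^+ i)%g P = P.
    by apply/polyP=> j; rewrite coef_map coef_map /= gal_fix.
  by rewrite fmorph_root.
have [rs PE] := closed_field_poly_normal P.
have [i [j [/andP[ltij _] eqf]]] : exists i j, (i < j <= size rs)%N /\
    x ^+ (q ^ i) = x ^+ (q ^ j).
  apply: (@pigeonhole_nat _ (fun i => x ^+ (q ^ i)) rs) => i; have := rP i.
  by rewrite PE rootZ ?lead_coef_eq0 // root_prod_XsubC.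
exists (j - i)%N; first by rewrite subn_gt0.
by apply: (@frobenius_pow_inj i); rewrite /= -exprM -expnD subnK // ltnW.
Qed.

(** The polynomial X^(q^m - 1) - 1 is separable, as q = 0 in K, and finite
    subgroups of a multiplicative group of a field are cyclic. *)
Lemma exists_primitive_root m : (0 < m)%N ->
  exists g : K, ((q ^ m).-1).-primitive_root g.
Proof.
move=> m0; set n := (q ^ m).-1.
have q1 := card_finField_gt1.
have n0 : (0 < n)%N by rewrite /n -ltnS prednK ?expn_gt0 ?(ltnW q1) // -(exp1n m) ltn_exp2r.
have nK : n%:R != 0 :> K.
  rewrite /n -subn1 natrB ?expn_gt0 ?(ltnW q1) // natrX.
  have -> : q%:R = 0 :> K.
    have [p pr_p pF] := finPcharP F.
    have E := card_pprimeChar pF; rewrite -[#|F|]/#|pPrimeCharType pF| E natrX.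
    have /andP[_ /eqP ->] : p \in [pchar K] by rewrite (fmorph_pchar iota).
    rewrite expr0n; case: logn E => // E1.
    by rewrite -[#|F|]/#|pPrimeCharType pF| E1 in q1.
  by rewrite expr0n gtn_eqF // sub0r oppr_eq0 oner_eq0.
have [rs rsE] := closed_field_poly_normal ('X^n - 1 : {poly K}).
have mon : ('X^n - 1 : {poly K}) \is monic by exact: monicXnsubC.
rewrite (monicP mon) scale1r in rsE.
have : has n.-primitive_root rs.
  apply: has_prim_root => //.
  - by apply/allP=> z zrs; rewrite /root_of_unity rsE root_prod_XsubC.
  - by rewrite -separable_prod_XsubC -rsE separable_Xn_sub_1.
  - have := size_XnsubC (1 : K) n0; rewrite rsE size_prod_XsubC.
    by case=> ->.
by case/hasP=> g _ gP; exists g.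
Qed.

(** With r = a mod m, the order q^m - 1 of g divides q^r - 1 < q^m - 1, so that
    r = 0. *)
Lemma primitive_frobenius_dvd m a g : (0 < m)%N ->
  ((q ^ m).-1).-primitive_root g -> g ^+ (q ^ a) = g -> (m %| a)%N.
Proof.
move=> m0 gP; have q1 := card_finField_gt1.
have q0 j : (0 < q ^ j)%N by rewrite expn_gt0 (ltnW q1).
have g0 : g != 0.
  apply/eqP=> g0; have := prim_expr_order gP; rewrite g0 expr0n.
  by rewrite gtn_eqF ?(prim_order_gt0 gP) // => /eqP; rewrite eq_sym oner_eq0.
have gm : g ^+ (q ^ m) = g.
  by rewrite -[X in _ ^+ X]prednK // exprS (prim_expr_order gP) mulr1.
rewrite (@frobenius_pow_mod m a (a %% m)) ?modn_mod // => gr.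
have : (0 < (q ^ (a %% m)).-1)%N -> False.
  move=> r0; have /dvdn_leq : ((q ^ m).-1 %| (q ^ (a %% m)).-1)%N.
    rewrite (prim_order_dvd gP); apply/eqP/(mulfI g0).
    by rewrite -exprS prednK // mulr1.
  move/(_ r0); rewrite -ltnS !prednK // leqNgt ltn_exp2l //.
  by rewrite ltn_mod m0.
case E : (a %% m)%N => [|r] H; first by apply/eqP.
by exfalso; apply: H; rewrite -ltnS prednK // -(exp1n r.+1) ltn_exp2r.
Qed.

Lemma frobenius_pow_eq_mod m a b : (0 < m)%N ->
  (forall x, x ^+ (q ^ m) = x -> x ^+ (q ^ a) = x ^+ (q ^ b)) ->
  a = b %[mod m].
Proof.
move=> m0 H; have [g gP] := exists_primitive_root m0.
have gm : g ^+ (q ^ m) = g.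
  rewrite -[X in _ ^+ X]prednK ?expn_gt0 ?(ltnW card_finField_gt1) //.
  by rewrite exprS (prim_expr_order gP) mulr1.
have {H} := H g gm; wlog leab : a b / (a <= b)%N.
  move=> W gab; have [ab|/ltnW ba] := leqP a b; first exact: W.
  exact/esym/W.
move=> gab; apply/eqP; rewrite eq_sym eqn_mod_dvd //.
apply: (primitive_frobenius_dvd m0 gP); apply: (@frobenius_pow_inj a).
by rewrite /= -exprM -expnD subnK.
Qed.

(** The product of the X - g^(q^i) over a full period of g is invariant under
    the Frobenius, hence has coefficients in F and is invariant under s. So s
    permutes its roots. *)
Lemma gal_frobenius_conjugate s m g : (0 < m)%N -> g ^+ (q ^ m) = g ->
  exists k, s g = g ^+ (q ^ k).
Proof.
case: m => // m _ gm.
pose p : {poly K} := \prod_(i < m.+1) ('X - (g ^+ (q ^ i))%:P).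
have pPhi : map_poly Phi p = p.
  rewrite rmorph_prod.
  transitivity (\prod_(i < m.+1) ('X - (g ^+ (q ^ i.+1))%:P)).
    apply: eq_bigr => i _; rewrite expnSr exprM.
    exact: (map_polyXsubC Phi (g ^+ (q ^ i))).
  by rewrite big_ord_recr /= mulrC gm /p big_ord_recl /= expr1.
have ps : map_poly s p = p.
  apply/polyP=> i; rewrite coef_map /=.
  have /frobenius_fixedE[a ->] : p`_i ^+ q = p`_i.
    by rewrite -[in RHS]pPhi coef_map.
  by rewrite gal_fix.
have : root p (s g).
  rewrite -ps fmorph_root /p big_ord_recl rootM expr1.
  by rewrite root_XsubC eqxx.
rewrite -[p](big_map (fun i : 'I_m.+1 => g ^+ (q ^ i)) xpredT
  (fun z => 'X - z%:P)) root_prod_XsubC => /mapP[i _ ->].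
by exists i.
Qed.

(** It suffices to know s on a generator of the multiplicative group of the
    field with q^m elements. *)
Lemma gal_locally_frobenius s m : (0 < m)%N ->
  exists k, forall x, x ^+ (q ^ m) = x -> s x = x ^+ (q ^ k).
Proof.
move=> m0; have [g gP] := exists_primitive_root m0.
have q0 : (0 < q ^ m)%N by rewrite expn_gt0 (ltnW card_finField_gt1).
have gm : g ^+ (q ^ m) = g.
  by rewrite -[X in _ ^+ X]prednK // exprS (prim_expr_order gP) mulr1.
have [k sg] := gal_frobenius_conjugate s m0 gm; exists k => x xm.
have [->|x0] := eqVneq x 0.
  by rewrite rmorph0 expr0n gtn_eqF // expn_gt0 (ltnW card_finField_gt1).
have /(prim_rootP gP)[i ->] : x ^+ (q ^ m).-1 = 1.
  by apply: (mulfI x0); rewrite -exprS prednK // mulr1.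
by rewrite rmorphXn /= sg -!exprM mulnC.
Qed.

Lemma gal_expE s k m a x : (forall y, y ^+ (q ^ m) = y -> s y = y ^+ (q ^ a)) ->
  x ^+ (q ^ m) = x -> (s ^+ k)%g x = x ^+ (q ^ (a * k)).
Proof.
move=> sE xm; elim: k => [|k IHk]; first by rewrite muln0 expr1.
rewrite expgS -[LHS]/(s ((s ^+ k)%g x)) IHk sE.
  by rewrite -exprM -expnD mulnSr.
by rewrite -!exprM -expnD addnC expnD exprM xm.
Qed.

(** Let s act on the field with q^M elements as Phi^(k M). As M grows these
    exponents are compatible, and k (N M) = k N mod N. So Phi^(k N)^-1 s acts on
    the field with q^(N M) elements as an N-th power of Phi^(e M), where
    e M = (k (N M) - k N) / N, and the Phi^(e M) on the fields with q^M elements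
    glue to an automorphism t. *)
Lemma gal_frobenius_mul_exp s N : is_algebraic_closure iota -> (0 < N)%N ->
  exists k t, s = (Phi ^+ k * t ^+ N)%g.
Proof.
move=> Kalg N0.
have /choice[k kP] : forall M, exists k, (0 < M)%N ->
    forall x, x ^+ (q ^ M) = x -> s x = x ^+ (q ^ k).
  move=> M; have [->|M0] := posnP M; first by exists 0%N.
  by have [k kP] := gal_locally_frobenius s M0; exists k.
have kmod M M' : (0 < M)%N -> (0 < M')%N -> (M %| M')%N -> k M' = k M %[mod M].
  move=> M0 M'0 dM; apply: frobenius_pow_eq_mod => // x xM.
  by rewrite -(kP M) // -(kP M') // (frobenius_pow_dvd dM).
(* The multiple N M (k N) of the period N M keeps the difference nonnegative. *)
pose e M := ((k (N * M) + N * M * k N - k N) %/ N)%N.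
have eE M : (0 < M)%N -> (e M * N + k N = k (N * M) + N * M * k N)%N.
  move=> M0; have NM0 : (0 < N * M)%N by rewrite muln_gt0 N0.
  have le : (k N <= k (N * M) + N * M * k N)%N.
    by apply: leq_trans (leq_addl _ _); rewrite leq_pmull.
  rewrite /e divnK ?subnK // -eqn_mod_dvd // -modnDmr -mulnA modnMr addn0.
  by apply/eqP/kmod => //; apply: dvdn_mulr.
have emod M M' : (0 < M)%N -> (0 < M')%N -> (M %| M')%N -> e M' = e M %[mod M].
  move=> M0 M'0 dM; apply/eqP; rewrite -(eqn_pmul2r N0) !muln_modl.
  rewrite -(eqn_modDr (k N)) !eE // (mulnC M N) -modnDmr -[X in _ == X]modnDmr.
  have dvd0 j : (M %| j)%N -> (N * j * k N %% (N * M) = 0)%N.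
    by move=> dj; apply/eqP; rewrite -/(dvdn _ _) dvdn_mulr // dvdn_pmul2l.
  rewrite !dvd0 // !addn0; apply/eqP/kmod; rewrite ?muln_gt0 ?N0 //.
  by rewrite dvdn_pmul2l.
have /choice[m mP] : forall x, exists m, (0 < m)%N /\ x ^+ (q ^ m) = x.
  by move=> x; have [m m0 xm] := algebraic_frobenius_period (Kalg x); exists m.
(* The value of t at x does not depend on the finite subfield chosen for x. *)
pose f x := x ^+ (q ^ e (m x)).
have fE M x : (0 < M)%N -> x ^+ (q ^ M) = x -> f x = x ^+ (q ^ e M).
  move=> M0 xM; have [m0 xm] := mP x.
  have mM0 : (0 < m x * M)%N by rewrite muln_gt0 m0.
  rewrite -(@frobenius_pow_mod M (e (m x * M))) ?emod ?dvdn_mull //.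
  by apply/esym/(@frobenius_pow_mod (m x)); rewrite ?emod ?dvdn_mulr.
have common x y : exists2 M, (0 < M)%N & x ^+ (q ^ M) = x /\ y ^+ (q ^ M) = y.
  have [[mx0 xm] [my0 ym]] := (mP x, mP y); exists (m x * m y)%N.
    by rewrite muln_gt0 mx0.
  by split; [apply: frobenius_pow_dvd xm; rewrite dvdn_mulr
            |apply: frobenius_pow_dvd ym; rewrite dvdn_mull].
have fB : zmod_morphism f.
  move=> x y; have [M M0 [xM yM]] := common x y.
  rewrite !(fE M) // -!frobenius_expE ?rmorphB //= !frobenius_expE.
  by rewrite xM yM.
have fM : monoid_morphism f.
  split=> [|x y]; first by rewrite /f expr1n.
  by have [M M0 [xM yM]] := common x y; rewrite !(fE M) // exprMn // xM yM.
have fbij : bijective f.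
  rewrite -setTT_bijective; split=> [x //|x y _ _|y _].
    have [M M0 [xM yM]] := common x y.
    by rewrite !(fE M) // => /frobenius_pow_inj.
  (* On the field with q^m elements Phi^(m e - e) inverts Phi^e. *)
  have [m0 ym] := mP y; exists (y ^+ (q ^ (m y * e (m y) - e (m y)))) => //.
  rewrite (fE (m y)) //; last by rewrite -!exprM -!expnD addnC expnD exprM ym.
  by rewrite -exprM -expnD subnK ?leq_pmull // mulnC frobenius_pow_mul.
have ffix a : f (iota a) = iota a.
  rewrite (fE 1%N) //; last by rewrite expn1 frobenius_fix.
  by rewrite -[e 1%N]muln1 frobenius_pow_mul // expn1 frobenius_fix.
exists (k N), (Defs.Gal fB fM fbij ffix); apply: Defs.galP => x; have [m0 xm] := mP x.
rewrite -[RHS]/((Phi ^+ k N)%g ((Defs.Gal fB fM fbij ffix ^+ N)%g x)).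
rewrite (@gal_expE _ N (m x) (e (m x))) // => [|y]; last exact: fE.
rewrite frobenius_expE -exprM -expnD eE //.
rewrite (kP (N * m x)%N) ?muln_gt0 ?N0 //; last exact: frobenius_pow_mul.
apply: (@frobenius_pow_mod (N * m x)); last exact: frobenius_pow_mul.
by rewrite -modnDmr modnMr addn0.
Qed.
End FrobeniusTopologicallyGenerates.

(** * Orbits of a locally finite module *)

Section OrbitsOfGaloisModules.
Variables (F : finFieldType) (K : closedFieldType) (emb : {rmorphism F -> K}).
Variable M : galModule emb.
Local Notation Phi := (frobenius emb).
Implicit Types (x y : M) (s t : Defs.gal emb) (O : set M).
Local Open Scope classical_set_scope.

Local Notation orb := (fun x : M => range (fun s => gm_act s x)).

Lemma gm_act_inj s : injective (gm_act s : M -> M).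
Proof.
move=> x y xy; rewrite -(gm_act1 x) -(gm_act1 y) -(mulVg s).
by rewrite !gm_actM xy.
Qed.

Lemma gm_act_expM s k n x : gm_act (s ^+ k)%g x = x ->
  gm_act (s ^+ (n * k))%g x = x.
Proof.
move=> sx; elim: n => [|n IHn]; first by rewrite mul0n gm_act1.
by rewrite mulSn expgD gm_actM IHn.
Qed.

Lemma orbits_orb x : orbits (orb x). Proof. by exists x. Qed.

Lemma mem_orb x : orb x x. Proof. by exists 1%g => //; rewrite gm_act1. Qed.

Lemma orb_eq x y : orb x y -> orb y = orb x.
Proof.
case=> s _ <-; apply/seteqP; split=> _ [t _ <-].
  by exists (t * s)%g => //; rewrite gm_actM.
by exists (t * s^-1)%g => //; rewrite -gm_actM -mulgA mulVg mulg1.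
Qed.

Lemma orbits_mem O x : orbits O -> O x -> O = orb x.
Proof. by case=> y -> /orb_eq. Qed.

Lemma deg_gt0 O : orbits O -> finite_set O -> (0 < deg O)%N.
Proof.
case=> x -> fin; rewrite /deg cardfs_gt0; apply/fset0Pn; exists x.
by rewrite in_fset_set // inE; exact: mem_orb.
Qed.

(** Some t^j with 0 < j <= deg fixes x, by the pigeonhole principle, and j
    divides deg!. *)
Lemma gm_act_fact_deg x t : finite_set (orb x) ->
  gm_act (t ^+ (deg (orb x))`!)%g x = x.
Proof.
move=> fin; set n := deg _.
have [i [j [/andP[ltij le_jn] eqf]]] : exists i j, (i < j <= n)%N /\
    gm_act (t ^+ i)%g x = gm_act (t ^+ j)%g x.
  apply: (@pigeonhole_nat _ (fun i => gm_act (t ^+ i)%g x) (fset_set (orb x))) => i.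
  by rewrite in_fset_set // inE; exists (t ^+ i)%g.
have tji : gm_act (t ^+ (j - i))%g x = x.
  apply: (@gm_act_inj (t ^+ i)%g).
  by rewrite -gm_actM -expgD subnKC ?eqf // ltnW.
have /dvdnP[c ->] : (j - i %| n`!)%N.
  apply: dvdn_fact; rewrite subn_gt0 ltij /=.
  exact: leq_trans (leq_subr _ _) le_jn.
exact: gm_act_expM.
Qed.

Hypothesis Kalg : is_algebraic_closure emb.

(** Write an automorphism as Phi^k t^N with N the factorial of the degree: the
    factor t^N fixes x. *)
Lemma orb_frobenius x : finite_set (orb x) ->
  orb x = range (fun k => gm_act (Phi ^+ k)%g x).
Proof.
move=> fin; apply/seteqP; split=> _ [s _ <-]; last by exists (Phi ^+ s)%g.
have [k [t ->]] := gal_frobenius_mul_exp s Kalg (fact_gt0 (deg (orb x))).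
by exists k => //; rewrite gm_actM gm_act_fact_deg.
Qed.

(** The powers of Phi are transitive on the orbit, so the least p > 0 such that
    Phi^p fixes x is the cardinality of the orbit. *)
Lemma frobenius_fix_deg x r : finite_set (orb x) ->
  gm_act (Phi ^+ r)%g x = x <-> (deg (orb x) %| r)%N.
Proof.
move=> fin.
have exp : exists p, (0 < p)%N && `[< gm_act (Phi ^+ p)%g x = x >].
  exists (deg (orb x))`!; rewrite fact_gt0; apply/asboolP.
  exact: gm_act_fact_deg.
case: (ex_minnP exp) => p /andP[p0 /asboolP xp] pmin.
have modE k : gm_act (Phi ^+ k)%g x = gm_act (Phi ^+ (k %% p))%g x.
  by rewrite {1}(divn_eq k p) addnC expgD gm_actM gm_act_expM.
have fixP k : gm_act (Phi ^+ k)%g x = x <-> (p %| k)%N.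
  split=> [|/dvdnP[c ->]]; last exact: gm_act_expM.
  rewrite modE => kx; rewrite /dvdn; have [//|r0] := posnP (k %% p).
  have /pmin : (0 < k %% p)%N && `[< gm_act (Phi ^+ (k %% p))%g x = x >].
    by rewrite r0; apply/asboolP.
  by rewrite leqNgt ltn_mod p0.
suff -> : deg (orb x) = p by [].
pose s := [seq gm_act (Phi ^+ (val k))%g x | k <- enum 'I_p].
have s_uniq : uniq s.
  rewrite map_inj_in_uniq ?enum_uniq // => i j _ _.
  wlog leij : i j / (i <= j)%N.
    by move=> W; case: (leqP i j) => [/W//|/ltnW/W + /esym] => /[apply].
  move=> eqij; apply: val_inj; apply/eqP; rewrite eqn_leq leij /= -subn_eq0.
  suff : (p %| j - i)%N.
    by case: posnP => // /dvdn_leq le /le; rewrite leqNgt (leq_ltn_trans (leq_subr _ _)).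
  apply/fixP; apply: (@gm_act_inj (Phi ^+ i)%g).
  by rewrite -gm_actM -expgD subnKC // eqij.
have -> : p = size s by rewrite size_map size_enum_ord.
apply: perm_size; apply: uniq_perm => // y.
rewrite in_fset_set //; apply/idP/mapP => [|[k _ ->]].
  rewrite inE orb_frobenius // => -[k _ <-].
  exists (Ordinal (ltn_pmod k p0)); first by rewrite mem_enum.
  by rewrite -modE.
by rewrite inE; exists (Phi ^+ k)%g.
Qed.

Hypothesis Mfin : locally_finite M.

Lemma finite_orb x : finite_set (orb x).
Proof. by case: Mfin => fin _; apply: fin; exact: orbits_orb. Qed.

Definition orbits_le n : set (set M) := [set O | orbits O /\ (deg O <= n)%N].

Lemma finite_orbits_le n : finite_set (orbits_le n).
Proof.
apply: (@sub_finite_set _ _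
  (\bigcup_(k in [set k | (0 < k <= n)%N]) [set O : set M | orbits O /\ deg O = k])).
  move=> O [OM degO]; exists (deg O) => //=; rewrite degO andbT.
  by apply: deg_gt0 => //; case: Mfin => + _; apply.
apply: bigcup_finite => [|k /andP[k0 _]]; last by case: Mfin => _; apply.
by apply: (@sub_finite_set _ _ `I_n.+1) => // k /andP[_]; rewrite /= ltnS.
Qed.

Lemma fixed_pointsE r x : @fixed_points _ _ _ M r x <-> (deg (orb x) %| r)%N.
Proof. exact: frobenius_fix_deg (finite_orb x). Qed.

Lemma finite_fixed_points r : (0 < r)%N -> finite_set (@fixed_points _ _ _ M r).
Proof.
move=> r0; apply: (@sub_finite_set _ _ (\bigcup_(O in orbits_le r) O)).
  move=> x /fixed_pointsE xr; exists (orb x); last exact: mem_orb.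
  by split; [exact: orbits_orb | exact: dvdn_leq].
apply: bigcup_finite => [|O [OM _]]; first exact: finite_orbits_le.
by case: Mfin => + _; apply.
Qed.

(** An orbit lies in the fixed point set of Phi^r if its degree divides r, and is
    disjoint from it otherwise. The bound n is free, so that one finite set of
    orbits serves for all r <= n. *)
Lemma card_fixed_sum r n : (0 < r <= n)%N ->
  card_fixed M r =
    (\sum_(O <- fset_set (orbits_le n)) (deg O %| r) * deg O)%N.
Proof.
case/andP=> r0 rn; have finr := finite_fixed_points r0.
have finn := finite_orbits_le n.
rewrite /card_fixed -sum1_size.
transitivity (\sum_(x <- fset_set (@fixed_points _ _ _ M r))
    \sum_(O <- fset_set (orbits_le n) | O == orb x) 1)%N.
  apply: eq_big_seq => x; rewrite in_fset_set // inE => /fixed_pointsE xr.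
  rewrite -big_filter filter_pred1_uniq ?big_seq1 ?fset_uniq // in_fset_set // inE.
  by split; [exact: orbits_orb | exact: leq_trans (dvdn_leq r0 xr) rn].
(* Each fixed point was counted at its own orbit; now count orbit by orbit. *)
rewrite (exchange_big_dep xpredT) //=; apply: eq_big_seq => O.
rewrite in_fset_set // inE => -[OM degO].
have finO : finite_set O by case: Mfin => + _; apply.
rewrite -big_filter sum1_size; have [dO|ndO] := boolP (deg O %| r)%N; last first.
  apply/eqP; rewrite size_eq0 -[_ == _]negbK -has_filter; apply/hasPn => x.
  rewrite in_fset_set // inE => /fixed_pointsE xr.
  by apply: contraNN ndO => /eqP ->.
rewrite mul1n; apply: perm_size; apply: uniq_perm; rewrite ?filter_uniq ?fset_uniq //.
move=> x; rewrite mem_filter !in_fset_set //; apply/andP/idP => [[/eqP -> _]|].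
  by rewrite inE; exact: mem_orb.
rewrite !inE => Ox; rewrite (orbits_mem OM Ox); split=> //.
by apply/fixed_pointsE; rewrite -(orbits_mem OM Ox).
Qed.
End OrbitsOfGaloisModules.

(** * Logarithmic derivatives of formal power series *)

Section FpsLogarithmicDerivative.
Variable R : comNzRingType.
Implicit Types (u v g : fps R) (c : R).

Lemma fps_coefD u v n : fps_coef (u + v) n = fps_coef u n + fps_coef v n.
Proof. by []. Qed.

Lemma fps_coefN u n : fps_coef (- u) n = - fps_coef u n.
Proof. by []. Qed.

Lemma fps_coefMn u k n : fps_coef (u *+ k) n = fps_coef u n *+ k.
Proof. by elim: k => // k IHk; rewrite !mulrS fps_coefD IHk. Qed.

Lemma fps_coef_sum (I : Type) (s : seq I) (f : I -> fps R) n :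
  fps_coef (\sum_(i <- s) f i) n = \sum_(i <- s) fps_coef (f i) n.
Proof. by elim: s => [|i s IHs]; rewrite ?big_nil // !big_cons fps_coefD IHs. Qed.

Lemma fps_of_polyM (p1 p2 : {poly R}) :
  fps_of_poly (p1 * p2) = fps_of_poly p1 * fps_of_poly p2.
Proof. by apply: fpsP => n; rewrite fps_coefM /= coefM. Qed.

Lemma fps_of_poly1 : fps_of_poly 1 = 1 :> fps R.
Proof. by apply: fpsP => n; rewrite fps_coef1 /= coef1. Qed.

Lemma fps_coef_geom c k n :
  fps_coef (fps_geom c k) n = if (k %| n)%N then c ^+ (n %/ k) else 0.
Proof. by []. Qed.

(** The derivation t d/dt, which unlike d/dt does not shift indices. The
    logarithmic derivative of f is a series g with [fps_euler f = f * g]; this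
    form of the equation needs neither logarithms nor quotients. *)
Definition fps_euler u : fps R := Fps (fun n => fps_coef u n *+ n).

Lemma fps_eulerM u v :
  fps_euler (u * v) = fps_euler u * v + u * fps_euler v.
Proof.
apply: fpsP => n; rewrite fps_coefD !fps_coefM /= -sumrMnl -big_split /=.
apply: eq_bigr => i _; rewrite mulrnAl mulrnAr -mulrnDr subnKC //.
by rewrite -ltnS.
Qed.

Lemma fps_euler1 : fps_euler 1 = 0.
Proof. by apply: fpsP => -[|n] //=; rewrite mul0rn. Qed.

Lemma fps_euler_prod (I : eqType) (s : seq I) (f g : I -> fps R) :
  (forall i, i \in s -> fps_euler (f i) = f i * g i) ->
  fps_euler (\prod_(i <- s) f i) = (\prod_(i <- s) f i) * \sum_(i <- s) g i.
Proof.
elim: s => [_|i s IHs fg]; first by rewrite !big_nil fps_euler1 mulr0.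
rewrite !big_cons fps_eulerM fg ?mem_head // IHs => [|j js].
  by rewrite mulrDr mulrAC !mulrA.
by rewrite fg // in_cons js orbT.
Qed.

Lemma fps_euler_binomial c k : (0 < k)%N ->
  fps_euler (fps_of_poly (1 - c *: 'X^k)) =
  fps_of_poly (1 - c *: 'X^k) * ((1 - fps_geom c k) *+ k).
Proof.
move=> k0; rewrite mulrnAr mulrBr mulr1 fps_geomP //; apply: fpsP => n.
rewrite fps_coefMn fps_coefD fps_coefN fps_coef1 /= coefB coef1 coefZ coefXn.
rewrite addrAC subrr add0r; have [->|_] := eqVneq n k; last first.
  by rewrite !mulr0 subr0 oppr0 mul0rn; case: n => [|n] //=; rewrite mul0rn.
by rewrite gtn_eqF // add0r.
Qed.

(** Differentiate p g = 1, where p = 1 - c t^k and g is its inverse. *)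
Lemma fps_euler_geom c k : (0 < k)%N ->
  fps_euler (fps_geom c k) = fps_geom c k * ((fps_geom c k - 1) *+ k).
Proof.
move=> k0; have pg := fps_geomP c k0; set p := fps_of_poly _ in pg.
have /(congr1 fps_euler) := pg.
rewrite fps_euler1 fps_eulerM fps_euler_binomial // -/p.
set g := fps_geom c k in pg *.
move/eqP; rewrite addrC addr_eq0 => /eqP pDg.
rewrite -[LHS]mul1r -{1}pg [p * g]mulrC -mulrA pDg mulrAC pg mul1r.
by rewrite -mulNrn opprB.
Qed.

Lemma fps_coefM_trunc u v m : (forall i, (i <= m)%N -> fps_coef v i = (i == 0%N)%:R) ->
  forall i, (i <= m)%N -> fps_coef (u * v) i = fps_coef u i.
Proof.
move=> v1 i im; rewrite -[in RHS](mulr1 u) !fps_coefM; apply: eq_bigr => j _.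
by rewrite fps_coef1 v1 // (leq_trans (leq_subr _ _)).
Qed.

End FpsLogarithmicDerivative.

Section FpsMap.
Variables (R S : comNzRingType) (f : {rmorphism R -> S}).

Definition fps_map (u : fps R) : fps S := Fps (fun n => f (fps_coef u n)).

Lemma fps_mapM u v : fps_map (u * v) = fps_map u * fps_map v.
Proof.
apply: fpsP => n; rewrite fps_coefM /= rmorph_sum.
by apply: eq_bigr => i _; rewrite rmorphM.
Qed.

Lemma fps_map_euler u : fps_map (fps_euler u) = fps_euler (fps_map u).
Proof. by apply: fpsP => n /=; rewrite rmorphMn. Qed.

Lemma fps_map_of_poly p : fps_map (fps_of_poly p) = fps_of_poly (map_poly f p).
Proof. by apply: fpsP => n /=; rewrite coef_map. Qed.

End FpsMap.

(** * The zeta function as a generating function of point counts *)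

Section ZetaAndPointCounts.
Variables (F : finFieldType) (K : closedFieldType) (emb : {rmorphism F -> K}).
Variable M : galModule emb.
Hypotheses (Kalg : is_algebraic_closure emb) (Mfin : locally_finite M).
Local Notation q := #|F|.

(** A finite Euler product; it has the same coefficients as the zeta function up
    to t^n, so that the product rule for finite products applies. *)
Definition zeta_le n : fps int :=
  \prod_(O <- fset_set (@orbits_le _ _ _ M n)) fps_geom 1 (deg O).

Lemma zetaE n : fps_coef (zeta M) n = fps_coef (zeta_le n) n.
Proof. by rewrite /zeta /= fsbig_finite //; exact: finite_orbits_le. Qed.

Lemma zeta_le_coef n i : (i <= n)%N ->
  fps_coef (zeta_le n) i = fps_coef (zeta M) i.
Proof.
move=> le_in; rewrite zetaE /zeta_le.
(* The factors of degree > i are 1 modulo t^(i + 1). *)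
rewrite (bigID (fun O : set M => deg O <= i)%N).
rewrite (@fps_coefM_trunc _ _ _ i) // => [|j ji].
  congr (fps_coef _ _); rewrite -big_filter; apply: perm_big.
  apply: uniq_perm; rewrite ?filter_uniq ?fset_uniq // => O.
  rewrite mem_filter !in_fset_set; try exact: finite_orbits_le.
  apply/andP/idP => [[Oi]|]; rewrite !inE => -[OM le_O]; split=> //.
  by split=> //; exact: leq_trans le_O le_in.
elim/big_rec: _ j ji => [|O u Oi IHu] j ji; first by rewrite fps_coef1.
rewrite -[LHS]/(fps_coef (fps_geom 1 (deg O) * u) j) mulrC (@fps_coefM_trunc _ _ _ i) // => [|l li]; first exact: IHu.
rewrite fps_coef_geom; case: l li => [|l] li; first by rewrite dvdn0 div0n.
by rewrite gtnNdvd // ltnNge (contraNN _ Oi) // => /leq_trans; apply.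
Qed.

Definition point_counts : fps int :=
  Fps (fun r => if r == 0%N then 0 else (card_fixed M r)%:R).

Lemma point_countsE r : (0 < r)%N -> fps_coef point_counts r = (card_fixed M r)%:R.
Proof. by case: r. Qed.

(** Modulo t^(n + 1) the zeta function is a finite Euler product. For r <= n the
    coefficient of t^r in its logarithmic derivative is the sum of orbit degrees
    in [card_fixed_sum]. *)
Lemma zeta_euler : fps_euler (zeta M) = zeta M * point_counts.
Proof.
apply: fpsP => n; have finn := @finite_orbits_le _ _ _ M Mfin n.
transitivity (fps_coef (fps_euler (zeta_le n)) n); first by rewrite /= zeta_le_coef.
have degP O : O \in fset_set (@orbits_le _ _ _ M n) -> (0 < deg O)%N.
  rewrite in_fset_set // inE => -[OM _]; apply: deg_gt0 => //.
  by case: Mfin => + _; apply.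
rewrite (fps_euler_prod (g := fun O => (fps_geom 1 (deg O) - 1) *+ deg O)); last first.
  by move=> O /degP; exact: fps_euler_geom.
rewrite -/(zeta_le n) !fps_coefM.
apply: eq_bigr => i _; rewrite zeta_le_coef; last by rewrite -ltnS.
congr (_ * _); have rn : (n - i <= n)%N := leq_subr _ _.
rewrite fps_coef_sum; have [->|r0] := posnP (n - i).
  by apply: big1 => O _; rewrite fps_coefMn fps_coefD fps_coefN fps_coef1
    fps_coef_geom dvdn0 div0n expr0 subrr mul0rn.
rewrite point_countsE // (card_fixed_sum Kalg Mfin (n := n)) ?r0 // natr_sum.
apply: eq_bigr => O _; rewrite fps_coefMn fps_coefD fps_coefN fps_coef1.
rewrite fps_coef_geom gtn_eqF // subr0 expr1n natrM.
by case: (deg O %| n - i)%N; rewrite ?mul1r ?mul0r ?mul0rn.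
Qed.

Lemma zeta_P1_euler : fps_euler (zeta_P1 F) =
  zeta_P1 F * ((fps_geom 1 1 - 1) + (fps_geom q%:R 1 - 1)).
Proof.
rewrite /zeta_P1 fps_eulerM !fps_euler_geom // !mulr1n.
set a := fps_geom 1 1; set b := fps_geom _ 1.
by rewrite (mulrAC a _ b) (mulrA a b) -mulrDr.
Qed.

Lemma zeta_P1_cancel (u v : fps int) : u * zeta_P1 F = v * zeta_P1 F -> u = v.
Proof.
have := (fps_geomP (1 : int) (k := 1) isT, fps_geomP (q%:R : int) (k := 1) isT).
set a := fps_of_poly _; set b := fps_of_poly _ => -[ga gb] uv.
have zab : zeta_P1 F * (a * b) = 1 by rewrite mulrC /zeta_P1 mulrACA ga gb mulr1.
by rewrite -[u]mulr1 -[v]mulr1 -zab (mulrA u) (mulrA v) uv.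
Qed.

Lemma zeta_quotient_unique P Q :
  is_zeta_quotient M P -> is_zeta_quotient M Q -> P = Q.
Proof.
rewrite /is_zeta_quotient => <- /zeta_P1_cancel QP; apply/polyP=> i.
exact: (congr1 (fun v => fps_coef v i) (esym QP)).
Qed.

Lemma zeta_quotient_euler P : is_zeta_quotient M P ->
  fps_euler (fps_of_poly P) = fps_of_poly P *
    (point_counts - ((fps_geom 1 1 - 1) + (fps_geom q%:R 1 - 1))).
Proof.
move=> PM; apply: zeta_P1_cancel; have := zeta_euler.
rewrite -PM fps_eulerM zeta_P1_euler => /(canRL (addrK _)) ->.
move: (zeta_P1 F) (fps_of_poly P) point_counts (_ - 1 + (_ - 1)) => z p N N1.
ring.
Qed.

(** Compare two expressions for the logarithmic derivative of P: one from the
    quotient of zeta functions, the other from its factorization. *)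
Lemma card_fixed_power_sum (C : comNzRingType) (P : {poly int}) m (w : 'I_m -> C) :
  is_zeta_quotient M P ->
  map_poly intr P = \prod_(i < m) (1 - w i *: 'X) ->
  forall r, (0 < r)%N -> (card_fixed M r)%:R = q%:R ^+ r + 1 - \sum_i w i ^+ r.
Proof.
move=> PM Pw r r0.
pose pw i := fps_of_poly (1 - w i *: 'X^1).
have PE : fps_of_poly (map_poly intr P) = \prod_(i < m) pw i.
  rewrite Pw; elim/big_ind2: _ => [|p1 u1 p2 u2 <- <-|i _] //.
  - exact: fps_of_poly1.
  - exact: fps_of_polyM.
pose u := \prod_(i < m) fps_geom (w i) 1.
have uP : u * (\prod_(i < m) pw i) = 1.
  rewrite -big_split big1 // => i _.
  by apply: etrans (mulrC _ _) _; exact: fps_geomP.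
have := congr1 (fps_map (intr : {rmorphism int -> C})) (zeta_quotient_euler PM).
rewrite fps_mapM fps_map_euler fps_map_of_poly PE.
rewrite (fps_euler_prod (g := fun i => (1 - fps_geom (w i) 1) *+ 1)); last first.
  by move=> i _; apply: fps_euler_binomial.
move/(congr1 (fun v => u * v)); rewrite /= !mulrA uP !mul1r.
move/(congr1 (fun v => fps_coef v r)).
rewrite fps_coef_sum /= gtn_eqF //.
have -> : \sum_(i < m) (false%:R - (if (1 %| r)%N then w i ^+ (r %/ 1) else 0)) =
    - \sum_(i < m) w i ^+ r.
  by rewrite -sumrN; apply: eq_bigr => i _; rewrite dvd1n divn1 sub0r.
rewrite dvd1n divn1 expr1n !subr0 rmorphB rmorphD rmorph1 rmorphXn /= !rmorph_nat.
by move/esym/eqP; rewrite subr_eq addrC [1 + _]addrC => /eqP.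
Qed.
End ZetaAndPointCounts.

(** * Power sums of complex numbers *)

Section PowerSums.
Variable R : realType.
Local Open Scope complex_scope.
Implicit Types (x c B C : R).

Lemma geometric_le_base x c B C r0 : 0 < c -> 0 <= x -> 0 < B ->
  (forall r, (r0 <= r)%N -> c * x ^+ r <= C * B ^+ r) -> x <= B.
Proof.
move=> c0 x0 B0 H; rewrite leNgt; apply/negP=> ltBx.
have xp : 0 < x by exact: lt_trans ltBx.
have z1 : `|B / x| < 1 by rewrite ger0_norm ?divr_ge0 ?ltW // ltr_pdivrMr ?mul1r.
have := cvg_geometric C z1 => /cvgrPdist_lt/(_ c c0)[N _ HN].
have := HN (maxn N r0) (leq_maxl _ _); have := H _ (leq_maxr N r0).
set r := maxn _ _; rewrite /geometric /= sub0r normrN => cx.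
apply/negP; rewrite -leNgt; apply: le_trans (ler_norm _).
by rewrite expr_div_n mulrA ler_pdivlMr ?exprn_gt0.
Qed.

Lemma normC_normc (z : R[i]) : `|z| = (Normc.normc z)%:C. Proof. by []. Qed.

Lemma normc_ge0 (z : R[i]) : 0 <= Normc.normc z.
Proof. by rewrite -lecR -normC_normc normr_ge0. Qed.

Lemma real_complexM x y : (x * y)%:C = x%:C * y%:C.
Proof. exact: (rmorphM (real_complex R)). Qed.

Lemma real_complexX x n : (x ^+ n)%:C = x%:C ^+ n.
Proof. exact: (rmorphXn (real_complex R)). Qed.

(** Let Q be the product of the X - b over the values b of a other than a_j.
    Then sum_k Q_k S_(r + k) = sum_i Q(a_i) a_i^r = n Q(a_j) a_j^r, where S_r are
    the power sums and n is the multiplicity of a_j. The left side is O(B^r) and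
    n Q(a_j) is nonzero. *)
Lemma power_sum_bound_terms m (a : 'I_m -> R[i]) B C r0 : 0 < B ->
  (forall r, (r0 <= r)%N -> `|\sum_i a i ^+ r| <= (C * B ^+ r)%:C) ->
  forall j, `|a j| <= B%:C.
Proof.
move=> B0 H j.
(* Repeated entries of a only repeat factors of Q, which is harmless. *)
pose Q := \prod_(b <- [seq a i | i : 'I_m] | b != a j) ('X - b%:P).
have Qaj : Q.[a j] != 0.
  rewrite horner_prod prodf_seq_neq0; apply/allP=> b _; apply/implyP=> baj.
  by rewrite hornerXsubC subr_eq0 eq_sym.
have Qai i : a i != a j -> Q.[a i] = 0.
  move=> aij; apply/eqP; rewrite horner_prod prodf_seq_eq0; apply/hasP.
  by exists (a i); rewrite ?map_f ?mem_enum // aij hornerXsubC subrr /=.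
pose n := #|[pred i | a i == a j]|.
have n0 : n%:R != 0 :> R[i].
  by rewrite pnatr_eq0 -lt0n; apply/card_gt0P; exists j; rewrite inE.
have QS r : \sum_(k < size Q) Q`_k * (\sum_i a i ^+ (r + k)) = n%:R * Q.[a j] * a j ^+ r.
  transitivity (\sum_i a i ^+ r * Q.[a i]).
    under eq_bigr do rewrite mulr_sumr; rewrite exchange_big /=.
    apply: eq_bigr => i _; rewrite horner_coef mulr_sumr; apply: eq_bigr => k _.
    by rewrite exprD mulrCA.
  rewrite (bigID (fun i => a i == a j)) /= [X in _ + X]big1 ?addr0; last first.
    by move=> i /Qai ->; rewrite mulr0.
  under eq_bigr => i /eqP -> do [].
  by rewrite sumr_const -[LHS]mulr_natl -[RHS]mulrA; congr (_ * _); exact: mulrC.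
rewrite normC_normc lecR.
pose c := Normc.normc (n%:R * Q.[a j]).
pose C' := \sum_(k < size Q) Normc.normc Q`_k * (C * B ^+ k).
apply: (@geometric_le_base _ c _ C' r0) => //; first last.
- move=> r rr0; rewrite -lecR real_complexM real_complexX -!normC_normc -normrX -normrM -QS.
  apply: le_trans (ler_norm_sum _ _ _) _.
  rewrite /C' mulr_suml (rmorph_sum (real_complex R)) /=; apply: ler_sum => k _.
  rewrite normrM normC_normc -mulrA real_complexM; apply: ler_wpM2l.
    by rewrite lecR normc_ge0.
  by rewrite -mulrA -exprD (addnC k); apply: H; exact: leq_trans rr0 (leq_addr _ _).
- exact: normc_ge0.
- by rewrite -ltcR -normC_normc normr_gt0 mulf_neq0.
Qed.

Lemma prod_extremal m (x : 'I_m -> R) B : 0 < B ->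
  (forall i, 0 <= x i <= B) -> \prod_i x i = B ^+ m -> forall i, x i = B.
Proof.
move=> B0 xB prodx j; apply/le_anti; have /andP[_ ->] := xB j.
have p0 : 0 < \prod_(i < m | i != j) B by exact: prodr_gt0.
have Bm : B ^+ m = B * \prod_(i < m | i != j) B.
  by rewrite -{1}(card_ord m) -prodr_const (bigD1 j).
rewrite /= -(ler_pM2r p0) -Bm -prodx (bigD1 j) //=.
by apply: ler_wpM2l; [have /andP[] := xB j | exact: ler_prod].
Qed.

(** From X - z = - z (1 - z^-1 X) for each root z; no root is 0 as P(0) = 1. *)
Lemma reciprocal_root_factorization (P : {poly int}) : P`_0 = 1 ->
  exists w : 'I_(size P).-1 -> R[i],
    map_poly intr P = \prod_i (1 - w i *: 'X) /\ (lead_coef P)%:~R = \prod_i - w i.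
Proof.
move=> P0; set p := map_poly intr P : {poly R[i]}.
have szp : size p = size P.
  by apply: size_map_inj_poly => //; apply: intr_inj.
have lp : lead_coef p = (lead_coef P)%:~R by rewrite /p lead_coef_map_inj //; apply: intr_inj.
have p00 : p`_0 = 1 by rewrite coef_map P0.
have lp0 : lead_coef p != 0.
  by rewrite lead_coef_eq0; apply/eqP=> pe; move/eqP: p00; rewrite pe coef0 eq_sym oner_eq0.
have [rs rsE] := closed_field_poly_normal p.
have szrs : size rs = (size P).-1.
  by rewrite -szp rsE size_scale // size_prod_XsubC.
have ev0 : lead_coef p * \prod_(z <- rs) - z = 1.
  apply: etrans p00; rewrite -horner_coef0 [in RHS]rsE hornerZ horner_prod; congr (_ * _).
  by apply: eq_bigr => z _; rewrite hornerXsubC sub0r.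
have rs0 z : z \in rs -> z != 0.
  move=> zrs; apply/eqP=> z0; have : \prod_(z <- rs) - z = 0.
    by apply/eqP; rewrite prodf_seq_eq0; apply/hasP; exists z; rewrite //= z0 oppr0.
  by move=> e; move/eqP: ev0; rewrite e mulr0 eq_sym oner_eq0.
exists (fun i => (rs`_i)^-1); rewrite -szrs; split; last first.
  under eq_bigr do rewrite -invrN.
  rewrite -(big_mkord xpredT (fun i => (- rs`_i)^-1)) -(big_nth 0 xpredT (fun z => (- z)^-1)).
  apply: (mulIf (x := \prod_(z <- rs) - z)).
    by apply: contraNneq (oner_neq0 R[i]) => e; rewrite -ev0 e mulr0.
  rewrite -lp ev0 -big_split big_seq big1 // => z zrs.
  by rewrite /= mulVf // oppr_eq0 rs0.
rewrite -/p rsE -(big_mkord xpredT (fun i => 1 - (rs`_i)^-1 *: 'X)).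
rewrite -(big_nth 0 xpredT (fun z => 1 - z^-1 *: 'X)).
rewrite -[RHS]scale1r -ev0 -scalerA -scaler_prod; congr (_ *: _).
rewrite !big_seq; apply: eq_bigr => z zrs.
rewrite scalerBr scalerA mulNr mulfV ?rs0 // scaleN1r opprK addrC.
by rewrite scaleNr alg_polyC.
Qed.
End PowerSums.

(** * The equivalence *)

Section ZetaQuotientPointCounts.
Variables (F : finFieldType) (K : closedFieldType) (emb : {rmorphism F -> K}).
Variable M : galModule emb.
Hypotheses (Kalg : is_algebraic_closure emb) (Mfin : locally_finite M).
Local Notation q := #|F|.
Local Open Scope complex_scope.

Lemma zeta_coef0 : fps_coef (zeta M) 0 = 1.
Proof.
rewrite zetaE // /zeta_le (_ : orbits_le _ = set0) ?fset_set0 ?big_nil //.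
apply/seteqP; split=> // O [OM]; rewrite leqNgt deg_gt0 //.
by case: Mfin => + _; apply.
Qed.

Lemma zeta_quotient_coef0 P : is_zeta_quotient M P -> P`_0 = 1.
Proof.
move/(congr1 (fun u => fps_coef u 0)); rewrite zeta_coef0 fps_coefM.
rewrite big_ord1 subn0 /zeta_P1 fps_coefM big_ord1 !fps_coef_geom !dvdn0 !div0n.
by rewrite !expr0 !mulr1.
Qed.

Lemma card_fixed_dist (R : realType) (P : {poly int}) m (w : 'I_m -> R[i]) :
  is_zeta_quotient M P ->
  map_poly intr P = \prod_(i < m) (1 - w i *: 'X) ->
  forall r, (0 < r)%N ->
  `|(card_fixed M r)%:R - (q%:R ^+ r + 1)|%:C = `|\sum_i w i ^+ r|.
Proof.
move=> PM Pw r r0.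
have -> : \sum_i w i ^+ r = - ((card_fixed M r)%:R - (q%:R ^+ r + 1) : R)%:C.
  rewrite (rmorphB (real_complex R)) (rmorphD (real_complex R)).
  rewrite (rmorphXn (real_complex R)) !(rmorph_nat (real_complex R)) (rmorph1 (real_complex R)).
  by rewrite (card_fixed_power_sum Kalg Mfin PM Pw) // addrAC subrr add0r opprK.
by rewrite normrN normc_def /= expr0n addr0 sqrtr_sqr.
Qed.
End ZetaQuotientPointCounts.

Lemma powR_log_base (R : realType) (b x : R) n : 1 < b -> 0 < x ->
  b `^ (ln x / ln b * n%:R) = x ^+ n.
Proof.
move=> b1 x0; have b0 : 0 < b by exact: lt_trans b1.
rewrite powRrM powR_mulrn ?powR_ge0 //; congr (_ ^+ _).
by rewrite /powR gt_eqF // divfK ?lnK // gt_eqF // ln_gt0.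
Qed.

Theorem proposition22 (R : realType) (F : finFieldType) (K : closedFieldType)
    (iota : {rmorphism F -> K}) (M : galModule iota) (P : {poly int}) (d : nat) :
  is_algebraic_closure iota ->
  locally_finite M ->
  is_zeta_quotient M P ->
  (0 < d)%N ->
  size P = d.+1 ->
  let q : R := #|F|%:R in
  let lambda : R := ln (`|P`_d|%:~R `^ (d%:R)^-1) / ln q in
  (riemann_hypothesis_analogue R M
   <->
   forall r : nat, (0 < r)%N ->
     q ^+ r + 1 - d%:R * q `^ (lambda * r%:R) <= (card_fixed M r)%:R
     /\ (card_fixed M r)%:R <= q ^+ r + 1 + d%:R * q `^ (lambda * r%:R))
  /\
  ((forall r : nat, (0 < r)%N ->
     q ^+ r + 1 - d%:R * q `^ (lambda * r%:R) <= (card_fixed M r)%:R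
     /\ (card_fixed M r)%:R <= q ^+ r + 1 + d%:R * q `^ (lambda * r%:R))
   <->
   exists (C1 C2 : R) (nu r1 r2 : nat),
     [/\ 0 < C1, 0 < C2, (0 < nu)%N, (0 < r1)%N & (0 < r2)%N]
     /\ (forall r : nat, (r1 <= r)%N ->
           (card_fixed M (nu * r))%:R
             <= q ^+ (nu * r) + 1 + C1 * q `^ (lambda * (nu * r)%:R))
     /\ (forall r : nat, (r2 <= r)%N ->
           q ^+ (nu * r) + 1 - C2 * q `^ (lambda * (nu * r)%:R)
             <= (card_fixed M (nu * r))%:R)).
Proof.
move=> Kalg Mfin PM d0 szP q lambda.
have dE : d = (size P).-1 by rewrite szP.
have lcE : P`_d = lead_coef P by rewrite lead_coefE dE.
have P0 : P != 0 by rewrite -size_poly_gt0 szP.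
have q1 : 1 < q by rewrite ltr1n card_finField_gt1.
pose rho : R := `|P`_d|%:~R `^ (d%:R)^-1.
have a0 : 0 < `|P`_d|%:~R :> R by rewrite ltr0z normr_gt0 lcE lead_coef_eq0.
have rho0 : 0 < rho by exact: powR_gt0.
have rhod : rho ^+ d = `|P`_d|%:~R.
  rewrite -powR_mulrn ?ltW // -powRrM mulVf ?powRr1 ?ltW //.
  by rewrite pnatr_eq0 -lt0n.
have rhoE : root_abs_lead R P = rho by rewrite /rho dE.
have powE r : q `^ (lambda * r%:R) = rho ^+ r by exact: powR_log_base.
have distP (a b c : R) : (a - c <= b) /\ (b <= a + c) <-> `|b - a| <= c.
  rewrite ler_distl; split=> [[-> ->] //|/andP[]] //.
have [w [Pw wlead]] := reciprocal_root_factorization R (zeta_quotient_coef0 Mfin PM).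
pose asymptotic_bounds := exists (C1 C2 : R) (nu r1 r2 : nat),
     [/\ 0 < C1, 0 < C2, (0 < nu)%N, (0 < r1)%N & (0 < r2)%N]
     /\ (forall r : nat, (r1 <= r)%N ->
           (card_fixed M (nu * r))%:R
             <= q ^+ (nu * r) + 1 + C1 * q `^ (lambda * (nu * r)%:R))
     /\ (forall r : nat, (r2 <= r)%N ->
           q ^+ (nu * r) + 1 - C2 * q `^ (lambda * (nu * r)%:R)
             <= (card_fixed M (nu * r))%:R).
have boundP : (forall r : nat, (0 < r)%N ->
     q ^+ r + 1 - d%:R * q `^ (lambda * r%:R) <= (card_fixed M r)%:R
     /\ (card_fixed M r)%:R <= q ^+ r + 1 + d%:R * q `^ (lambda * r%:R)) <->
    (forall r, (0 < r)%N ->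
      `|(card_fixed M r)%:R - (q ^+ r + 1)| <= d%:R * rho ^+ r).
  by split=> H r r0; apply/distP; have := H r r0; rewrite ?powE // => /distP.
have RH_bound : riemann_hypothesis_analogue R M ->
    forall r, (0 < r)%N ->
      `|(card_fixed M r)%:R - (q ^+ r + 1)| <= d%:R * rho ^+ r.
  case=> P' [w' [P'M P'w w'rho]] r r0.
  have PP' : P' = P by apply: zeta_quotient_unique P'M PM.
  subst P'; rewrite -lecR (card_fixed_dist Kalg Mfin P'M P'w r0).
  apply: le_trans (ler_norm_sum _ _ _) _.
  under eq_bigr do rewrite normrX w'rho rhoE.
  rewrite sumr_const card_ord -dE mulr_natl -real_complexX.
  by rewrite -(rmorphMn (real_complex R)).
have bound_asymp :
    (forall r, (0 < r)%N ->
      `|(card_fixed M r)%:R - (q ^+ r + 1)| <= d%:R * rho ^+ r) -> asymptotic_bounds.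
  move=> bound; exists d%:R, d%:R, 1%N, 1%N, 1%N; rewrite ltr0n; split=> //.
  by split=> r r0; rewrite mul1n powE; have [] := (distP _ _ _).2 (bound r r0).
have asymp_RH : asymptotic_bounds -> riemann_hypothesis_analogue R M.
  case=> C1 [C2 [nu [r1 [r2 [[C10 C20 nu0 r10 r20] [up lo]]]]]].
  (* The hypotheses bound the power sums of the w_i^nu. *)
  have wle i : Normc.normc (w i) <= rho.
    rewrite -lecR -normC_normc -(@ler_pXn2r _ nu) ?nnegrE ?normr_ge0 //; last first.
      by rewrite lecR ltW.
    rewrite -normrX -real_complexX.
    apply: (@power_sum_bound_terms _ _ (fun i => w i ^+ nu) _ (C1 + C2) (maxn r1 r2)).
      exact: exprn_gt0.
    move=> r; rewrite geq_max => /andP[rr1 rr2].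
    under eq_bigr do rewrite -exprM.
    rewrite -(card_fixed_dist Kalg Mfin PM Pw) ?muln_gt0 ?nu0 ?(leq_trans r10) // lecR.
    rewrite -exprM ler_distl mulrDl; have := up _ rr1; have := lo _ rr2; rewrite !powE.
    have := exprn_gt0 (nu * r) rho0; set t := rho ^+ _ => t0.
    have := mulr_gt0 C10 t0; have := mulr_gt0 C20 t0; rewrite /q; lra.
  have wrho : forall i, Normc.normc (w i) = rho.
    apply: prod_extremal => // [i|]; first by rewrite normc_ge0 wle.
    have -> : rho ^+ (size P).-1 = `|lead_coef P|%:~R by rewrite -dE rhod lcE.
    apply: (@complexI R); rewrite (rmorph_prod (real_complex R)) /=.
    under eq_bigr do rewrite -normC_normc -normrN.
    rewrite -normr_prod -wlead -intr_norm; exact/esym/(rmorph_int (real_complex R)).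
  exists P, [tuple w i | i < (size P).-1]; split=> // [|i].
    by rewrite Pw; apply: eq_bigr => i _; rewrite tnth_mktuple.
  by rewrite tnth_mktuple normC_normc wrho rhoE.
split; split; first by move/RH_bound/boundP.
- by move/boundP/bound_asymp/asymp_RH.
- by move/boundP/bound_asymp.
- by move/asymp_RH/RH_bound/boundP.
Qed.
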